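(* Let $q$ be a prime with $q\equiv 1\pmod 4$ and let $\xi$ be an element of order $4$ in $\mathbb{Z}_q^\times$. Up to isomorphism, there is a unique left brace of size $4q$ with additive group isomorphic to $\mathbb{Z}_2^2\times\mathbb{Z}_q$ and with $|\ker\lambda|=q$. It is $(B,+,\circ)$ with $B=\mathbb{Z}_q\times\mathbb{Z}_2\times\mathbb{Z}_2$ and $$\begin{pmatrix} n\\ m\\ l\end{pmatrix}+\begin{pmatrix} x\\ y\\ z\end{pmatrix}=\begin{pmatrix} n+x\\ m+y\\ l+z\end{pmatrix},\qquad \begin{pmatrix} n\\ m\\ l\end{pmatrix}\circ\begin{pmatrix} x\\ y\\ z\end{pmatrix}=\begin{pmatrix} n+\xi^{2m+l}x\\ m+y+lz\\ l+z\end{pmatrix}$$ for $0\le n,x\le q-1$ and $0\le m,l,y,z\le 1$ (in the exponent of $\xi$, $m$ and $l$ are the integer representatives in $\{0,1\}$; components are taken modulo $q$, $2$, $2$ respectively). In particular, $(B,\circ)\cong\mathbb{Z}_q\rtimes_\xi\mathbb{Z}_4$.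
   Context: A skew (left) brace is a triple $(B,+,\circ)$ where $(B,+)$ and $(B,\circ)$ are groups such that $a\circ(b+c)=a\circ b-a+a\circ c$ for all $a,b,c\in B$; it is a left brace if $(B,+)$ is abelian. The map $\lambda:(B,\circ)\to\mathrm{Aut}(B,+)$, $\lambda_a(b)=-a+a\circ b$, is a group homomorphism, with kernel $\ker\lambda$. Isomorphisms are bijections preserving both operations. $\mathbb{Z}_q\rtimes_\xi\mathbb{Z}_4=\langle\sigma,\tau\mid\sigma^4=\tau^q=1,\ \sigma\tau\sigma^{-1}=\tau^\xi\rangle$. *)

(* Defs.v *)
From HB Require Import structures.
From mathcomp Require Import all_boot all_order all_fingroup all_algebra.
From mathcomp Require Import all_solvable.

Set Implicit Arguments.
Unset Strict Implicit.
Unset Printing Implicit Defensive.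

Import GroupScope.

(* The additive group of a skew brace need not be abelian. *)
Record skew_brace (T : finType) := SkewBrace {
  badd : T -> T -> T;
  bzero : T;
  bopp : T -> T;
  bcirc : T -> T -> T;
  bone : T;
  binv : T -> T;
  baddA : associative badd;
  badd0l : left_id bzero badd;
  baddNl : left_inverse bzero bopp badd;
  bcircA : associative bcirc;
  bcirc1l : left_id bone bcirc;
  bcircVl : left_inverse bone binv bcirc;
  bcircD : forall a b c,
    bcirc a (badd b c) = badd (badd (bcirc a b) (bopp a)) (bcirc a c)
}.

Definition is_left_brace (T : finType) (B : skew_brace T) : Prop :=
  commutative (badd B).

(* The groups (B,+) and (B,o): copies of the carrier, each with its own
   (multiplicatively written) group law. *)
Definition add_group (T : finType) (B : skew_brace T) : Type := T.
Definition circ_group (T : finType) (B : skew_brace T) : Type := T.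

HB.instance Definition _ (T : finType) (B : skew_brace T) :=
  Finite.on (add_group B).
HB.instance Definition _ (T : finType) (B : skew_brace T) :=
  Finite_isGroup.Build (add_group B) (@baddA T B) (@badd0l T B) (@baddNl T B).

HB.instance Definition _ (T : finType) (B : skew_brace T) :=
  Finite.on (circ_group B).
HB.instance Definition _ (T : finType) (B : skew_brace T) :=
  Finite_isGroup.Build (circ_group B)
    (@bcircA T B) (@bcirc1l T B) (@bcircVl T B).

Definition lambda (T : finType) (B : skew_brace T) (a b : T) : T :=
  badd B (bopp B a) (bcirc B a b).

(* lambda is a homomorphism (B,o) -> Aut(B,+) for the composition
   (f g)(x) = f (g x); the library composes permutations in the opposite order,
   so the kernel is spelled out instead of being the 'ker of a morphism into
   {perm T}. *)
Definition ker_lambda (T : finType) (B : skew_brace T) : {set T} :=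
  [set a | [forall b, lambda B a b == b]].

Definition brace_isom (T U : finType) (B : skew_brace T) (C : skew_brace U) :
    Prop :=
  exists f : T -> U,
    [/\ bijective f, {morph f : a b / badd B a b >-> badd C a b}
      & {morph f : a b / bcirc B a b >-> bcirc C a b}].

Lemma lambda_add (T : finType) (B : skew_brace T) (a : T) :
  {morph lambda B a : b c / badd B b c}.
Proof. by move=> b c; rewrite /lambda bcircD !baddA. Qed.

Lemma lambda_circ (T : finType) (B : skew_brace T) (a b c : T) :
  lambda B (bcirc B a b) c = lambda B a (lambda B b c).
Proof.
rewrite {3}/lambda lambda_add.
have mK (x y : add_group B) : badd B (bopp B x) (badd B x y) = y := mulKg x y.
have Mx (x y : add_group B) :
  bopp B (badd B x y) = badd B (bopp B y) (bopp B x) := invMg x y.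
have lamN (x : add_group B) : lambda B a (bopp B x) = bopp B (lambda B a x).
  have l0 : lambda B a (bzero B) = bzero B.
    apply: (@mulgI (add_group B) (lambda B a (bzero B))).
    by rewrite -[LHS]lambda_add badd0l [RHS](@mulg1 (add_group B)).
  apply: (@mulIg (add_group B) (lambda B a x)).
  by rewrite -[LHS]lambda_add baddNl l0 [RHS](@mulVg (add_group B)).
rewrite lamN /lambda Mx bcircA -baddA; congr badd.
have -> : bopp B (bopp B a) = a := @invgK (add_group B) a.
by rewrite [RHS](@mulKVg (add_group B)).
Qed.

(* Defining data of the left brace on Z_q x Z_2 x Z_2; as exponents and in
   2 * m + l, elements of 'Z_2 are read as their representatives in {0, 1}. *)
Definition kerq_add (q : nat) (u v : 'Z_q * 'Z_2 * 'Z_2) :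
    'Z_q * 'Z_2 * 'Z_2 :=
  let: (n, m, l) := u in let: (x, y, z) := v in
  (n + x, m + y, l + z)%R.

Definition kerq_circ (q : nat) (xi : {unit 'Z_q}) (u v : 'Z_q * 'Z_2 * 'Z_2) :
    'Z_q * 'Z_2 * 'Z_2 :=
  let: (n, m, l) := u in let: (x, y, z) := v in
  (n + val xi ^+ (2 * nat_of_ord m + nat_of_ord l)%N * x,
   m + y + l * z, l + z)%R.

(* [set: 'Z_n] is the additive group of 'Z_n. *)
Definition is_kerq_brace (q : nat) (T : finType) (B : skew_brace T) : Prop :=
  [/\ is_left_brace B,
      #|T| = (4 * q)%N,
      [set: add_group B] \isog [set: 'Z_2 * 'Z_2 * 'Z_q]
    & #|ker_lambda B| = q].

(* Main.v *)
(** Transport a brace C as in the statement to A = Z_q x V, V = Z_2 x Z_2, along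
    its additive isomorphism.  On ker lambda the operations + and o agree, so
    ker lambda is an additive subgroup of order q, hence equal to Z_q; and every
    lambda_u preserves Z_q and V.  So lambda_(x,v) depends on v only, acting on
    Z_q as multiplication by some chi v and on V as some mu v, and
    v |-> (chi v, mu v) is injective.

    If v o v = 0 for all v in V, then chi takes values in {1, -1}, so chi v = 1
    for some v <> 0; as mu v v = v, a w in V with mu v w <> w would satisfy
    v o w = w, which is absurd, so mu v = 1, contradicting injectivity.  Hence
    e = f o f <> 0 for some f.  Then mu f f = f + e, mu f e = e and mu e = 1,
    so chi e = -1 and chi f is xi or - xi; replacing f by f + e changes its
    sign.  In the basis (e, f) of V, C has the required form. *)

Require Import Defs.
From HB Require Import structures.
From mathcomp Require Import all_boot all_order all_fingroup all_algebra.
From mathcomp Require Import all_solvable ring.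

Set Implicit Arguments.
Unset Strict Implicit.
Unset Printing Implicit Defensive.

Import GroupScope.
Import GRing.Theory.

(** * Arithmetic in Z_q and Z_2 x Z_2 *)

(* (m, l) |-> 2 m + l identifies (Z_2 x Z_2, o) with Z_4: l z is the carry. *)
Lemma kerq_expD (m l y z : 'Z_2) :
  (2 * (m + y + l * z)%R + (l + z)%R = (2 * m + l) + (2 * y + z) %[mod 4])%N.
Proof.
by move: m l y z => [[|[|//]] ?] [[|[|//]] ?] [[|[|//]] ?] [[|[|//]] ?].
Qed.

(** Euclid's lemma on representatives; it turns equal squares into equality up to sign. *)
Lemma Zp_mulf_eq0 (q : nat) (x y : 'Z_q) :
  prime q -> (x * y = 0)%R -> x = 0%R \/ y = 0%R.
Proof.
move=> q_pr /(congr1 val) /= /eqP.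
have Dq := Zp_cast (prime_gt1 q_pr).
rewrite -/(_ %| _) [X in X %| _]Dq Euclid_dvdM //.
have z (t : 'Z_q) : q %| t -> t = 0%R.
  move=> qt; apply: val_inj; move: qt => /=; rewrite -{1}Dq /dvdn modn_small //.
  by move/eqP.
by case/orP => /z; [left | right].
Qed.

Lemma klein_addvv (v : 'Z_2 * 'Z_2) : (v + v = 0)%R.
Proof. by move: v => [[[|[|//]] ?] [[|[|//]] ?]]; congr pair; apply: val_inj. Qed.

Lemma klein_cases (e f w : 'Z_2 * 'Z_2) :
    e <> 0%R -> f <> 0%R -> f <> e ->
  [\/ w = 0, w = e, w = f | w = e + f]%R.
Proof.
have E (a b : 'Z_2 * 'Z_2) : (a == b) -> a = b by move/eqP.
have N (a b : 'Z_2 * 'Z_2) : a <> b -> (a != b) by move/eqP.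
(* As booleans, the three hypotheses compute to false in the excluded cases of the enumeration. *)
move=> /N + /N + /N.
move: e f w => [[[|[|//]] ?] [[|[|//]] ?]] [[[|[|//]] ?] [[|[|//]] ?]].
all: move=> [[[|[|//]] ?] [[|[|//]] ?]] //= _ _ _.
all: by [apply: Or41; apply: E | apply: Or42; apply: E
        | apply: Or43; apply: E | apply: Or44; apply: E].
Qed.

(** * Powers of xi and the brace axioms for the model *)

Section OrderFour.

Variables (q : nat) (xi : {unit 'Z_q}).
Hypothesis xi_order : #[xi] = 4%N.

Lemma val_unit_expg4 : (val xi ^+ 4 = 1)%R.
Proof. by rewrite -FinRing.val_unitX -[4%N]xi_order expg_order. Qed.

Lemma val_unit_expg2_neq1 : (val xi ^+ 2 != 1)%R.
Proof.
rewrite -FinRing.val_unitX; apply/eqP => xi2.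
have: #[xi] %| 2 by rewrite order_dvdn; apply/eqP; apply: val_inj.
by rewrite xi_order.
Qed.

Lemma val_unit_expg2 : prime q -> (val xi ^+ 2 = -1)%R.
Proof.
move=> q_prime; have: ((val xi ^+ 2 - 1) * (val xi ^+ 2 + 1) = 0)%R.
  by rewrite -subr_sqr expr1n -exprM val_unit_expg4 subrr.
case/(Zp_mulf_eq0 q_prime) => /eqP; last by rewrite addr_eq0 => /eqP.
by rewrite subr_eq0 (negPf val_unit_expg2_neq1).
Qed.

(** Exponents of xi matter only modulo 4, so [kerq_expD] applies. Associativity of [kerq_circ] rests
    on this in the first coordinate. *)
Lemma kerq_exprD (m l y z : 'Z_2) :
  (val xi ^+ (2 * (m + y + l * z)%R + (l + z)%R)%N
   = val xi ^+ (2 * m + l)%N * val xi ^+ (2 * y + z)%N)%R.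
Proof.
rewrite -exprD -(expr_mod _ val_unit_expg4) kerq_expD.
by rewrite (expr_mod _ val_unit_expg4).
Qed.

Lemma kerq_addA : associative (@kerq_add q).
Proof. by move=> [[n m] l] [[x y] z] [[n' m'] l'] /=; rewrite !addrA. Qed.

Lemma kerq_add0l : left_id (0, 0, 0)%R (@kerq_add q).
Proof. by move=> [[n m] l] /=; rewrite !add0r. Qed.

Definition kerq_opp (u : 'Z_q * 'Z_2 * 'Z_2) : 'Z_q * 'Z_2 * 'Z_2 :=
  let: (n, m, l) := u in (- n, - m, - l)%R.

Lemma kerq_addNl : left_inverse (0, 0, 0)%R kerq_opp (@kerq_add q).
Proof. by move=> [[n m] l] /=; rewrite !addNr. Qed.

Lemma kerq_circA : associative (kerq_circ xi).
Proof.
move=> [[n m] l] [[x y] z] [[n' m'] l'] /=.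
by rewrite kerq_exprD; congr (_, _, _)%R; ring.
Qed.

Lemma kerq_circ1l : left_id (0, 0, 0)%R (kerq_circ xi).
Proof.
by move=> [[n m] l] /=; rewrite !add0r mul0r expr0 mul1r addr0.
Qed.

(** Solves u' o u = 0 from the last coordinate back: l' = - l, then m' + m + l' l = 0, then n' +
    xi^(2m'+l') n = 0. *)
Definition kerq_inv (u : 'Z_q * 'Z_2 * 'Z_2) : 'Z_q * 'Z_2 * 'Z_2 :=
  let: (n, m, l) := u in
  let m' := (l * l - m)%R in let l' := (- l)%R in
  (- (val xi ^+ (2 * nat_of_ord m' + nat_of_ord l')%N * n), m', l')%R.

Lemma kerq_circVl : left_inverse (0, 0, 0)%R kerq_inv (kerq_circ xi).
Proof.
by move=> [[n m] l] /=; rewrite !addNr mulNr subrK subrr.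
Qed.

Lemma kerq_circD u v w :
  kerq_circ xi u (kerq_add v w)
  = kerq_add (kerq_add (kerq_circ xi u v) (kerq_opp u)) (kerq_circ xi u w).
Proof.
move: u v w => [[n m] l] [[x y] z] [[n' m'] l'] /=.
by congr (_, _, _)%R; ring.
Qed.

Definition kerq_brace : skew_brace ('Z_q * 'Z_2 * 'Z_2)%type :=
  SkewBrace kerq_addA kerq_add0l kerq_addNl kerq_circA kerq_circ1l kerq_circVl
            kerq_circD.

End OrderFour.

(** * The action lambda of a brace on Z_q x (Z_2 x Z_2) *)

Section LambdaKleinCyclic.

Variables (q : nat) (xi : {unit 'Z_q}).
Hypotheses (q_prime : prime q) (q_odd : odd q) (xi_order : #[xi] = 4%N).

Local Notation V := ('Z_2 * 'Z_2)%type.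
Local Notation A := ('Z_q * V)%type.

Let xi_sqr := val_unit_expg2 xi_order q_prime.

(* L abstracts lambda: L_comp is lambda_circ, since a o b = a + lambda_a b. *)
Variable L : A -> A -> A.
Hypotheses (L_add : forall u, {morph L u : v w / (v + w)%R})
  (L_comp : forall u v w : A, L (u + L u v)%R w = L u (L v w))
  (L_inj : forall u, injective (L u))
  (card_ker : #|[set u | [forall v, L u v == v]]| = q).

Let L0 u : L u 0%R = 0%R.
Proof. by apply: (addrI (L u 0%R)); rewrite -L_add !addr0. Qed.

Let L_mulrn (u v : A) n : L u (v *+ n)%R = (L u v *+ n)%R.
Proof. by elim: n => [|n IHn]; rewrite ?mulr0n ?L0 // !mulrS L_add IHn. Qed.

Let fstMn (a : A) n : (a *+ n)%R.1 = (a.1 *+ n)%R.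
Proof. by elim: n => // n IHn; rewrite !mulrS -IHn. Qed.

Let sndMn (a : A) n : (a *+ n)%R.2 = (a.2 *+ n)%R.
Proof. by elim: n => // n IHn; rewrite !mulrS -IHn. Qed.

Let mulrn_odd (v : V) n : odd n -> (v *+ n = v)%R.
Proof.
move=> n_odd; rewrite -(odd_double_half n) n_odd mulrS -mul2n mulrnA.
by rewrite mulr2n klein_addvv mul0rn addr0.
Qed.

Let mulrnq (x : 'Z_q) : (x *+ q = 0)%R.
Proof. by rewrite -mulr_natr pchar_Zp ?mulr0 // prime_gt1. Qed.

Let L0l v : L 0%R v = v.
Proof. by apply: (@L_inj 0%R); rewrite -L_comp L0 addr0. Qed.

Let L_Zq x u : L (x, 0)%R u = u.
Proof.
pose K := [set u | [forall v, L u v == v]].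
have KP w : reflect (forall v, L w v = v) (w \in K).
  by rewrite inE; apply: (iffP forallP) => H v; apply/eqP.
have gK : group_set K.
  apply/group_setP; split; first by apply/KP.
  move=> a b /KP Ka /KP Kb; apply/KP => v.
  (* Since L a b = b, the sum a + b is a + L a b, to which [L_comp] applies. *)
  by rewrite -[b]Ka L_comp Ka Kb.
have sK : K \subset [set ((x, 0) : A)%R | x : 'Z_q].
  apply/subsetP=> -[y v] Kv; apply/imsetP; exists y => //.
  (* The q-fold of an element of K is 0, while multiplication by the odd q is the identity on V, so
     v = 0. *)
  have := @expg_cardG _ (Group gK) _ Kv; rewrite /= card_ker => /(congr1 snd).
  have -> : (((y, v) : A) ^+ q).2 = (v *+ q)%R := sndMn (y, v) q.
  by rewrite (mulrn_odd v q_odd) => v0; congr pair; exact: v0.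
have defK : K = [set ((x, 0) : A)%R | x : 'Z_q].
  apply/eqP; rewrite eqEcard sK card_imset => [|a b /(congr1 fst)//].
  by rewrite card_ker card_ord Zp_cast ?leqnn ?prime_gt1.
by move: u; apply/KP; rewrite defK imset_f.
Qed.

Let chi (v : V) : 'Z_q := (L (0, v)%R (1, 0)%R).1.
Let mu (v w : V) : V := (L (0, v)%R (0, w)%R).2.

Let L_E x v y w : L (x, v) (y, w) = (chi v * y, mu v w)%R.
Proof.
(* (x, v) = (x, 0) o (0, v), so L (x, v) = L (0, v). *)
have -> : (x, v) = ((x, 0) + L (x, 0) (0, v))%R :> A.
  by rewrite L_Zq; congr pair; rewrite ?addr0 ?add0r.
rewrite L_comp L_Zq.
(* (1, 0) is its own multiple by q + 1, which is even and kills V; in [Lw], (0, w) is its own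
   multiple by q, which kills Z_q. *)
have L1 : ((L (0, v) (1, 0)).2 = 0)%R.
  have E1 : ((1, 0) *+ q.+1 = (1, 0) :> A)%R.
    by rewrite [LHS]surjective_pairing fstMn sndMn mulrS mulrnq addr0 mul0rn.
  rewrite -[in LHS]E1 L_mulrn sndMn mulrS mulrn_odd ?klein_addvv //.
have Lw : ((L (0, v) (0, w)).1 = 0)%R.
  have Ew : ((0, w) *+ q = (0, w) :> A)%R.
    by rewrite [LHS]surjective_pairing fstMn sndMn mulrnq mulrn_odd.
  by rewrite -[in LHS]Ew L_mulrn fstMn mulrnq.
have -> : (y, w) = ((1, 0) *+ (nat_of_ord y) + (0, w))%R :> A.
  rewrite [in RHS](surjective_pairing ((1, 0) *+ _)%R) fstMn sndMn mul0rn /=.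
  by congr pair; rewrite ?addr0 ?add0r // natr_Zp.
rewrite L_add L_mulrn [LHS]surjective_pairing; congr pair => /=.
  by rewrite fstMn Lw addr0 -mulr_natr natr_Zp.
by rewrite sndMn L1 mul0rn add0r.
Qed.

Let mu_add v : {morph mu v : a b / (a + b)%R}.
Proof.
move=> a b; rewrite /mu.
have -> : (0, a + b)%R = ((0, a) + (0, b))%R :> A by congr pair; rewrite addr0.
by rewrite L_add.
Qed.

Let mu0 v : mu v 0%R = 0%R.
Proof. by rewrite /mu L0. Qed.

Let pair_addL (v w : V) : ((0, v) + L (0, v) (0, w) = (0, v + mu v w))%R.
Proof. by rewrite L_E mulr0; congr pair; rewrite addr0. Qed.

(** By [pair_addL], v + mu v w is the circle product on V; [mu] and [chi] are multiplicative for
    it. *)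
Let mu_comp (v w a : V) : mu (v + mu v w)%R a = mu v (mu w a).
Proof. by rewrite {1}/mu -pair_addL L_comp !L_E. Qed.

Let chi_comp (v w : V) : chi (v + mu v w)%R = (chi v * chi w)%R.
Proof. by rewrite {1}/chi -pair_addL L_comp !L_E mulr1. Qed.

Let mu_inj v : injective (mu v).
Proof.
move=> a b ab; suff [] : (0, a)%R = (0, b)%R :> A by [].
by apply: (@L_inj (0, v)%R); rewrite !L_E ab.
Qed.

(** A nonzero such v would put (0, v) in the kernel besides the q elements of Z_q. *)
Let faithful v : chi v = 1%R -> (forall a, mu v a = a) -> v = 0%R.
Proof.
move=> chi1 mu1; apply/eqP; apply: contraT => v_neq0.
pose K := [set u | [forall v, L u v == v]].
have KP w : (forall v, L w v = v) -> w \in K.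
  by move=> H; rewrite inE; apply/forallP => u; apply/eqP.
have sK : (0, v)%R |: [set ((x, 0) : A)%R | x : 'Z_q] \subset K.
  apply/subsetP=> w /setU1P[-> | /imsetP[x _ ->]]; apply: KP => // -[y a].
  by rewrite L_E chi1 mu1 mul1r.
move/subset_leq_card: sK.
rewrite card_ker cardsU1 card_imset => [|a b /(congr1 fst)//].
rewrite card_ord; case: imsetP => [[x _ [_ v0]]|_].
  by rewrite v0 eqxx in v_neq0.
by rewrite Zp_cast ?ltnn ?prime_gt1.
Qed.

Let addv_eq (a b : V) : (a + b = 0)%R -> a = b.
Proof. by move=> ab; rewrite -[a]addr0 -(klein_addvv b) addrA ab add0r. Qed.

(** The hypothesis reads v o w = w, so mu v mu w = mu w, and mu w is invertible. *)
Let mu_id (v w : V) : (v + mu v w = w)%R -> forall a, mu v a = a.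
Proof.
move=> vw a; have := mu_comp v w (invF (@mu_inj w) a).
by rewrite vw f_invF.
Qed.

Let chi0 : chi 0%R = 1%R. Proof. by rewrite /chi L0l. Qed.

Let chi_sqr (v : V) : (v + mu v v = 0)%R -> chi v = 1%R \/ chi v = (-1)%R.
Proof.
move=> vv; have := chi_comp v v; rewrite vv chi0 => cv.
have: ((chi v - 1) * (chi v + 1) = 0)%R.
  by rewrite -subr_sqr expr1n expr2 -cv subrr.
case/(Zp_mulf_eq0 q_prime) => /eqP.
  by rewrite subr_eq0 => /eqP; left.
by rewrite addr_eq0 => /eqP; right.
Qed.

Let ex_order4 : exists f : V, (f + mu f f)%R <> 0%R.
Proof.
case: (boolP [exists f : V, (f + mu f f != 0)%R]) => [/existsP[f /eqP] | nf].
  by exists f.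
have sq0 (v : V) : (v + mu v v = 0)%R.
  by apply/eqP; apply: contraR nf => nv; apply/existsP; exists v.
have chi_neq1 (v : V) : v <> 0%R -> chi v <> 1%R.
  move=> v_neq0 chi1; case: v_neq0; apply: faithful => // w.
  have vv : mu v v = v by apply/esym/addv_eq.
  case: (eqVneq v 0%R) => [-> | /eqP v0]; first by rewrite /mu L0l.
  case: (eqVneq w 0%R) => [-> | /eqP w0]; first by rewrite mu0.
  case: (eqVneq w v) => [-> // | /eqP wv].
  (* Injectivity excludes the values 0 and v; the value v + w gives v o w = w. *)
  case: (klein_cases (mu v w) v0 w0 wv) => // vw.
  - by case: w0; apply: (@mu_inj v); rewrite mu0.
  - by case: wv; apply: (@mu_inj v); rewrite vv.
  - by apply: (@mu_id v w); rewrite vw addrA klein_addvv add0r.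
pose a : V := (1, 0)%R; pose b : V := (0, 1)%R.
have a0 : a <> 0%R by [].
have b0 : b <> 0%R by [].
have chiN (v : V) : v <> 0%R -> chi v = (-1)%R.
  by move=> v0; case: (chi_sqr (sq0 v)) => // /(chi_neq1 v v0).
(* chi (a o b) = (-1)(-1) = 1 forces a o b = 0; then mu a b = a = mu a a, against a <> b. *)
case: (chi_neq1 (a + mu a b)%R); last first.
  by rewrite chi_comp !chiN // mulrNN mulr1.
move/addv_eq => ab.
by have/mu_inj : mu a a = mu a b by rewrite -ab; apply/esym/addv_eq.
Qed.

(** In the coordinates (m, l) of m e + l f, this is the lambda of the model, as in
    [kerq_lambdaE]. *)
Lemma kerq_basis : exists e f : V,
  [/\ e <> 0%R, f <> 0%R & f <> e] /\
  forall x y (m l z k : 'Z_2),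
    L (x, e *+ m + f *+ l)%R (y, e *+ z + f *+ k)%R
    = (val xi ^+ (2 * m + l)%N * y, e *+ (z + l * k)%R + f *+ k)%R.
Proof.
have [f] := ex_order4.
have [e defe] : exists e, e = (f + mu f f)%R by exists (f + mu f f)%R.
rewrite -defe => ff.
have muff : mu f f = (f + e)%R by rewrite defe addrA klein_addvv add0r.
have f0 : f <> 0%R by move=> f0; apply: ff; rewrite defe f0 mu0 addr0.
have fe : f <> e.
  move=> fe; move: muff; rewrite -fe klein_addvv => H.
  by apply: f0; apply: (@mu_inj f); rewrite H mu0.
(* The value f would give f o (e + f) = e + f, hence mu f = 1, against mu f f = f + e; the value e +
   f is already taken at f. *)
have mufe : mu f e = e.
  case: (klein_cases (mu f e) ff f0 fe) => // H.
  - by case: ff; apply: (@mu_inj f); rewrite mu0.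
  - have mu_f1 : forall a, mu f a = a.
      apply: (@mu_id f (e + f)%R).
      by rewrite mu_add H muff !addrA klein_addvv add0r addrC.
    move: muff; rewrite mu_f1 => /(congr1 (+%R f)).
    by rewrite addrA klein_addvv add0r => /esym.
  - by case: fe; apply: (@mu_inj f); rewrite muff H addrC.
(* e = f o f, and mu f squares to the identity: it fixes e and adds e to f. *)
have mue a : mu e a = a.
  rewrite defe mu_comp.
  suff H w : mu f (mu f w) = w by [].
  by case: (klein_cases w ff f0 fe) => ->;
    rewrite ?mu_add ?mu0 ?muff ?mufe ?mu_add ?muff ?mufe ?addrA // -?addrA;
    rewrite ?klein_addvv ?addr0 ?add0r.
have chie : chi e = (-1)%R.
  case: (@chi_sqr e) => //; first by rewrite mue klein_addvv.
  by move=> c1; case: ff; apply: faithful.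
have chif : (chi f ^+ 2 = -1)%R by rewrite expr2 -chi_comp -defe.
(* f + e = f o e because mu f fixes e. *)
have chife : chi (f + e)%R = (- chi f)%R.
  by rewrite -{1}mufe chi_comp chie mulrN1.
have mufe' a : mu (f + e)%R a = mu f a.
  by rewrite -{1}mufe mu_comp mue.
have [g [g0 ge chig mug mug2]] : exists g : V,
    [/\ g <> 0, g <> e, chi g = val xi, mu g g = g + e & mu g e = e]%R.
  have: ((chi f - val xi) * (chi f + val xi) = 0)%R.
    by rewrite -subr_sqr chif xi_sqr subrr.
  case/(Zp_mulf_eq0 q_prime) => /eqP.
    by rewrite subr_eq0 => /eqP ?; exists f.
  rewrite addr_eq0 => /eqP cf; exists (f + e)%R; split.
  - by move/addv_eq.
  - by move/(congr1 (+%R^~ e)); rewrite -addrA klein_addvv addr0.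
  - by rewrite chife cf opprK.
  - by rewrite mufe' mu_add muff mufe.
  - by rewrite mufe'.
(* e + g = e o g since mu e = 1, and (-1) xi = xi^3 is the case m = l = 1. *)
have chieg : chi (e + g)%R = (val xi ^+ 3)%R.
  by rewrite -{1}(mue g) chi_comp chie chig exprS xi_sqr mulN1r mulrN1.
have mueg a : mu (e + g)%R a = mu g a by rewrite -{1}(mue g) mu_comp mue.
have mug0 a : mu 0%R a = a by rewrite /mu L0l.
exists e, g; split=> // x y m l z k.
rewrite L_E; congr pair.
  congr (_ * _)%R; move: m l => [[|[|//]] ?] [[|[|//]] ?] /=;
    rewrite ?mulr0n ?mulr1n ?addr0 ?add0r ?chi0 ?chieg ?expr0 ?expr1;
    by rewrite ?xi_sqr ?chie ?chig.
move: m l z k => [[|[|//]] ?] [[|[|//]] ?] [[|[|//]] ?] [[|[|//]] ?] /=;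
  rewrite ?mulr0n ?mulr1n ?addr0 ?add0r ?mueg ?mu_add ?mu0 ?mug0 ?mue;
  rewrite ?mug ?mug2 //.
all: by [rewrite addrC | rewrite (addrC g) addrA klein_addvv add0r].
Qed.

End LambdaKleinCyclic.

(** * The brace on Z_q x Z_2 x Z_2 and its circle group *)

Section KerqBrace.

Variables (q : nat) (xi : {unit 'Z_q}).
Hypotheses (q_prime : prime q) (xi_order : #[xi] = 4%N).

Local Notation B := (kerq_brace xi_order).

Lemma card_kerq : #|{: 'Z_q * 'Z_2 * 'Z_2}| = (4 * q)%N.
Proof.
by rewrite !card_prod !card_ord Zp_cast ?prime_gt1 // -mulnA mulnC.
Qed.

Lemma kerq_lambdaE (n x : 'Z_q) (m l y z : 'Z_2) :
  lambda B (n, m, l) (x, y, z)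
  = (val xi ^+ (2 * nat_of_ord m + nat_of_ord l)%N * x, y + l * z, z)%R.
Proof. by rewrite /lambda /=; congr (_, _, _)%R; ring. Qed.

Lemma kerq_kerE : ker_lambda B = [set (n, 0, 0)%R | n : 'Z_q].
Proof.
apply/setP=> -[[n m] l]; rewrite inE; apply/forallP/imsetP => [H | [n' _ ->]].
  (* The first test vector gives xi^(2m+l) = 1, the second l = 0; then xi^2 <> 1 forces m = 0. *)
  exists n => //; move: (H (1, 0, 0)%R) (H (0, 0, 1)%R).
  rewrite !kerq_lambdaE !mulr1 mulr0 !add0r.
  move=> /eqP/(congr1 (fst \o fst)) /= E1 /eqP/(congr1 (snd \o fst)) /= l0.
  move: E1; rewrite l0 addn0; move: m {H} => [[|[|//]] i]; last first.
    by move/eqP; rewrite (negPf (val_unit_expg2_neq1 xi_order)).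
  by move=> _; congr (_, _, _); apply: val_inj.
by move=> [[x y] z]; rewrite kerq_lambdaE expr0 mul1r mul0r addr0.
Qed.

Lemma kerq_braceP : is_kerq_brace q B.
Proof.
split.
- by move=> [[n m] l] [[x y] z]; congr (_, _, _)%R; apply: addrC.
- exact: card_kerq.
- pose f (u : add_group B) : 'Z_2 * 'Z_2 * 'Z_q :=
    let: (n, m, l) := u : 'Z_q * 'Z_2 * 'Z_2 in (m, l, n).
  have fM : {in [set: add_group B] &, {morph f : u v / u * v}}.
    by move=> [[n m] l] [[x y] z].
  apply/isogP; exists (Morphism fM).
    by apply/injmP=> -[[n m] l] [[x y] z] _ _ [-> -> ->].
  rewrite morphimEdom; apply/setP=> -[[m l] n]; rewrite inE; apply/imsetP.
  by exists (n, m, l).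
- rewrite kerq_kerE card_imset => [|a b [] //].
  by rewrite card_ord Zp_cast ?prime_gt1.
Qed.

(** * Homomorphisms from the circle group to groups satisfying the relations *)

Section Presentation.

Variables (rT : finGroupType) (s t : rT).
Hypotheses (s4 : s ^+ 4 = 1) (tq : t ^+ q = 1)
  (sts : s * t * s^-1 = t ^+ nat_of_ord (val xi)).

Lemma expgZpD (a b : 'Z_q) : t ^+ (a + b)%R = t ^+ a * t ^+ b.
Proof.
by rewrite -expgD /= [X in _ %% X]Zp_cast ?prime_gt1 // expg_mod.
Qed.

Lemma expgZpM (a b : 'Z_q) : t ^+ (a * b)%R = t ^+ a ^+ b.
Proof.
by rewrite -expgM /= [X in _ %% X]Zp_cast ?prime_gt1 // expg_mod.
Qed.

(** Conjugation by s raises powers of t to the power xi; this is iterated k times. *)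
Lemma expg_conj_swap k (x : 'Z_q) :
  s ^+ k * t ^+ x = t ^+ (val xi ^+ k * x)%R * s ^+ k.
Proof.
elim: k x => [|k IHk] x; first by rewrite expr0 mul1r mulg1 mul1g.
rewrite expgS -mulgA IHk mulgA exprS -mulrA (expgZpM (val xi)) -sts.
have -> : s * t * s^-1 = t ^ s^-1 by rewrite conjgE invgK mulgA.
by rewrite -conjXg conjgE invgK -!mulgA mulKg.
Qed.

(** Normal form t^n s^k, with k in Z_4 written as 2m + l. *)
Definition kerq_hom (u : circ_group B) : rT :=
  let: (n, m, l) := u : 'Z_q * 'Z_2 * 'Z_2 in
  t ^+ n * s ^+ (2 * nat_of_ord m + nat_of_ord l)%N.

Lemma kerq_homM : {in [set: circ_group B] &, {morph kerq_hom : u v / u * v}}.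
Proof.
move=> [[n m] l] [[x y] z] _ _.
change (t ^+ (n + val xi ^+ (2 * m + l)%N * x)%R
    * s ^+ (2 * (m + y + l * z)%R + (l + z)%R)%N
  = t ^+ n * s ^+ (2 * m + l) * (t ^+ x * s ^+ (2 * y + z))).
have -> : s ^+ (2 * (m + y + l * z)%R + (l + z)%R)%N
    = s ^+ (2 * m + l) * s ^+ (2 * y + z).
  by rewrite -expgD -(expg_mod _ s4) kerq_expD expg_mod.
by rewrite expgZpD -!mulgA; congr (_ * _); rewrite !mulgA expg_conj_swap.
Qed.

Canonical kerq_morphism := Morphism kerq_homM.

Lemma im_kerq_hom : kerq_hom @* [set: circ_group B] = <[s]> <*> <[t]>.
Proof.
apply/eqP; rewrite eqEsubset join_subG !cycle_subG; apply/and3P; split.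
- apply/subsetP=> _ /morphimP[[[n m] l] _ _ ->] /=.
  by rewrite groupM // groupX // mem_gen // inE ?cycle_id ?orbT.
- suff: s \in kerq_hom @* [set: circ_group B] by [].
  apply/morphimP; exists (0, 0, 1)%R; rewrite ?inE //=.
  by rewrite mul1g modn_small // expg1.
- suff: t \in kerq_hom @* [set: circ_group B] by [].
  apply/morphimP; exists (1, 0, 0)%R; rewrite ?inE //=.
  by rewrite mulg1 modn_small // expg1.
Qed.

End Presentation.

(** The circle group has generators satisfying the relations, and any group generated by such a pair
    is its image under [kerq_hom]. *)
Lemma kerq_presentation :
  [set: circ_group B] \isog Grp (s : t :
    s ^+ 4, t ^+ q, s * t * s^-1 = t ^+ (nat_of_ord (val xi))).
Proof.
pose s : circ_group B := (0, 0, 1)%R : 'Z_q * 'Z_2 * 'Z_2.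
pose t : circ_group B := (1, 0, 0)%R : 'Z_q * 'Z_2 * 'Z_2.
have tX n : t ^+ n = (n%:R, 0, 0)%R :> ('Z_q * 'Z_2 * 'Z_2).
  elim: n => // n IHn; rewrite expgS.
  change (t * t ^+ n) with (bcirc B t (t ^+ n)); rewrite IHn /=.
  by rewrite muln0 expr0 mul1r mul0r !addr0 -natr1 addrC.
have sX2 : s ^+ 2 = (0, 1, 0)%R :> ('Z_q * 'Z_2 * 'Z_2).
  change (kerq_circ xi s s = (0, 1, 0)%R) => /=.
  by rewrite mulr0 addr0; congr (_, _, _); apply: val_inj.
have sX4 : s ^+ 4 = 1.
  rewrite -[4%N]/(2 * 2)%N expgM sX2.
  change (kerq_circ xi (0, 1, 0) (0, 1, 0) = (0, 0, 0))%R => /=.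
  by rewrite mulr0 addr0; congr (_, _, _); apply: val_inj.
have tq : t ^+ q = 1 by rewrite tX pchar_Zp ?prime_gt1.
have sts : s * t * s^-1 = t ^+ nat_of_ord (val xi).
  apply: (canLR (mulgK s)); rewrite tX natr_Zp.
  change (kerq_circ xi (0, 0, 1) (1, 0, 0)
    = kerq_circ xi (val xi, 0, 0) (0, 0, 1))%R => /=.
  by rewrite muln0 add0n expr1 !(mulr0, mulr1, mul0r, add0r, addr0).
have sX (m l : 'Z_2) :
    s ^+ (2 * m + l) = (0, m, l)%R :> ('Z_q * 'Z_2 * 'Z_2).
  rewrite expgD expgM sX2; move: m l => [[|[|//]] i] [[|[|//]] j];
    rewrite ?expg0 ?expg1 ?mulg1 ?mul1g //=.
  - by congr (_, _, _); apply: val_inj.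
  - by congr (_, _, _); apply: val_inj.
  - by congr (_, _, _); apply: val_inj.
  change (kerq_circ xi (0, 1, 0)%R (0, 0, 1)%R
    = (0%R, Ordinal i, Ordinal j)) => /=.
  by rewrite !(mulr0, mul0r, addr0, add0r); congr (_, _, _); apply: val_inj.
have defG : <[s]> <*> <[t]> = [set: circ_group B].
  apply/eqP; rewrite eqEsubset subsetT; apply/subsetP=> -[[n m] l] _.
  have -> : ((n, m, l) : circ_group B) = t ^+ n * s ^+ (2 * m + l).
    rewrite sX tX natr_Zp.
    change ((n, m, l) = kerq_circ xi (n, 0, 0)%R (0, m, l)%R) => /=.
    by rewrite !(mulr0, mul0r, add0r, addr0).
  by rewrite groupM // groupX // mem_gen // inE ?cycle_id ?orbT.
apply: (@intro_isoGrp _ [set: circ_group B]%G) => [|rT G].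
  by apply/existsP; exists (s, t); rewrite /= defG sX4 tq sts.
case/existsP=> -[x y] /= /eqP[<- x4 yq xyx].
apply/homgP; exists (kerq_morphism x4 yq xyx).
exact: im_kerq_hom.
Qed.

End KerqBrace.

(** * Uniqueness *)

(** The map is (n, m, l) |-> psi (n, m e + l f'), with psi an additive isomorphism onto [C] and (e,
    f') given by [kerq_basis]. *)
Lemma kerq_classification (q : nat) (xi : {unit 'Z_q}) (T : finType)
    (C : skew_brace T) :
    prime q -> odd q -> #[xi] = 4%N -> is_kerq_brace q C ->
  exists g : 'Z_q * 'Z_2 * 'Z_2 -> T,
    [/\ bijective g, {morph g : u v / kerq_add u v >-> badd C u v}
      & {morph g : u v / kerq_circ xi u v >-> bcirc C u v}].
Proof.
move=> q_prime q_odd xi_order [_ cardT /isogP[f /injmP f_inj _] card_ker].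
pose phi (t : T) : 'Z_q * ('Z_2 * 'Z_2) :=
  let: (a, b, c) := f t : 'Z_2 * 'Z_2 * 'Z_q in (c, (a, b)).
have fM (a b : add_group C) : f (badd C a b) = (f a + f b)%R.
  by rewrite -[RHS](morphM f) ?inE.
have phiM a b : phi (badd C a b) = (phi a + phi b)%R.
  by rewrite /phi fM; case: (f a) => [[? ?] ?]; case: (f b) => [[? ?] ?].
have phi_inj : injective phi.
  move=> a b ab; apply: f_inj; rewrite ?inE //; move: ab; rewrite /phi.
  by case: (f a) => [[? ?] ?]; case: (f b) => [[? ?] ?] [-> -> ->].
have cardA : #|{: 'Z_q * ('Z_2 * 'Z_2)}| = #|T|.
  by rewrite cardT !card_prod !card_ord Zp_cast ?prime_gt1 // mulnC.
have [psi phiK psiK] := inj_card_bij phi_inj (eq_leq cardA).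
have psiM a b : psi (a + b)%R = badd C (psi a) (psi b).
  by apply: phi_inj; rewrite phiM !psiK.
have addK (x y : add_group C) : badd C x (badd C (bopp C x) y) = y := mulKVg x y.
have addI (x : add_group C) : injective (badd C x) := mulgI x.
have circI (x : circ_group C) : injective (bcirc C x) := mulgI x.
(* lambda transported to Z_q x V; by [psiL], u + L u v is the transported circle product. *)
pose L u v := phi (lambda C (psi u) (psi v)).
have L_add u : {morph L u : v w / (v + w)%R}.
  by move=> v w; rewrite /L psiM lambda_add phiM.
have psiL u v : psi (u + L u v)%R = bcirc C (psi u) (psi v).
  by rewrite psiM phiK addK.
have L_comp u v w : L (u + L u v)%R w = L u (L v w).
  by rewrite {1}/L psiL lambda_circ /L phiK.
have L_inj u : injective (L u).
  by move=> v w /phi_inj/addI/circI/(can_inj psiK).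
have card_kerL : #|[set u | [forall v, L u v == v]]| = q.
  rewrite -[RHS]card_ker -(card_imset _ phi_inj); apply: eq_card => u.
  rewrite !inE; apply/forallP/imsetP => [H | [a + -> v]].
    exists (psi u); rewrite ?psiK // inE; apply/forallP=> t.
    by have := H (phi t); rewrite /L phiK (inj_eq phi_inj).
  by rewrite inE => /forallP/(_ (psi v)) /eqP E; rewrite /L phiK E psiK.
have [e [f' [[e0 f0 fe] LE]]] :=
  kerq_basis q_prime q_odd xi_order L_add L_comp L_inj card_kerL.
pose c (m l : 'Z_2) := (e *+ m + f' *+ l)%R.
have cD m l y z : c (m + y)%R (l + z)%R = (c m l + c y z)%R.
  (* Multiples use representatives; the reduction of 1 + 1 to 0 is harmless as v + v = 0. *)
  have Z2D (v : 'Z_2 * 'Z_2) (a b : 'Z_2) :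
      (v *+ (a + b)%R = v *+ a + v *+ b)%R.
    rewrite -mulrnDr; move: a b => [[|[|//]] ?] [[|[|//]] ?] //=.
    by rewrite mulr2n klein_addvv.
  by rewrite /c !Z2D addrACA.
have c_eq0 m l : c m l = 0%R -> (m = 0 /\ l = 0)%R.
  rewrite /c; move: m l => [[|[|//]] ?] [[|[|//]] ?];
    rewrite ?mulr0n ?mulr1n ?addr0 ?add0r => c0 //.
  - by split; apply: val_inj.
  - by case: fe; rewrite -[LHS]add0r -(klein_addvv e) -addrA c0 addr0.
pose g (u : 'Z_q * 'Z_2 * 'Z_2) : T := let: (n, m, l) := u in psi (n, c m l).
have gM : {morph g : u v / kerq_add u v >-> badd C u v}.
  by move=> [[n m] l] [[x y] z]; rewrite /g /kerq_add cD -psiM.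
exists g; split => //.
- apply: inj_card_bij; last first.
    by rewrite cardT !card_prod !card_ord Zp_cast ?prime_gt1 // -mulnA mulnC.
  move=> [[n m] l] [[x y] z] /(can_inj psiK) gg.
  have {gg} [-> cc] : n = x /\ c m l = c y z.
    by split; [exact: (congr1 fst gg) | exact: (congr1 snd gg)].
  (* By additivity of c, injectivity reduces to its trivial kernel. *)
  have : c (m - y)%R (l - z)%R = 0%R.
    by apply: (addIr (c y z)); rewrite -cD !subrK cc add0r.
  case/c_eq0 => /eqP; rewrite subr_eq0 => /eqP-> /eqP.
  by rewrite subr_eq0 => /eqP->.
- move=> [[n m] l] [[x y] z]; rewrite /g /kerq_circ -psiL LE -addrA cD.
  by congr psi.
Qed.

Theorem lemma8p2 (q : nat) (xi : {unit 'Z_q}) (q_prime : prime q)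
    (q_mod4 : q = 1 %[mod 4]) (xi_order : #[xi] = 4%N) :
  exists B : skew_brace ('Z_q * 'Z_2 * 'Z_2)%type,
    [/\ forall u v, badd B u v = kerq_add u v,
        forall u v, bcirc B u v = kerq_circ xi u v,
        is_kerq_brace q B,
        forall (T : finType) (C : skew_brace T),
          is_kerq_brace q C -> brace_isom C B
      & [set: circ_group B] \isog Grp (s : t :
          s ^+ 4, t ^+ q, s * t * s^-1 = t ^+ (nat_of_ord (val xi)))].
Proof.
have q_odd : odd q by rewrite (divn_eq q 4) q_mod4 oddD oddM andbF.
exists (kerq_brace xi_order); split=> //.
- exact: kerq_braceP.
- move=> T C /(kerq_classification q_prime q_odd xi_order).
  (* [g] starts from the model, so the isomorphism from [C] is its inverse [h]. *)
  case=> g [[h gK hK] gD gC]; exists h.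
  split; first by exists g.
    by move=> a b; apply: (can_inj gK); rewrite hK gD !hK.
  by move=> a b; apply: (can_inj gK); rewrite hK gC !hK.
- exact: kerq_presentation.
Qed.
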